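(* Let $T$ and $T'$ be inversions tableaux for a permutation $w$ such that $T'$ is obtained from $T$ by a series of chute moves. Then for all $(i,j)\in\mathrm{Inv}(w)$, we have $\Lambda(T)(i,j)\le\Lambda(T')(i,j)$.
   Context: For $w=w_1\cdots w_n\in S_n$, $\mathrm{Inv}(w)=\{(i,j): i<j,\ w_j<w_i\}$. The staircase consists of the boxes $(i,j)$, $1\le i<j\le n$ (row $i$, column $j$, rows drawn with index increasing from bottom to top); box $(i,j)$ is shaded if $(i,j)\in\mathrm{Inv}(w)$. An inversions tableau for (of shape) $w$ assigns a number $T(i,j)\in\{1,\dots,n\}$ to each shaded box, with $T(i,j)=0$ for unshaded boxes, such that: (IT1) for all $i<j$, $T(i,j)$ is the median (counting multiplicities) of the entries in the hook $\{(i,j)\}\cup\{(i',j): i<i'<j\}\cup\{(i,j'): i<j'<j\}$; (IT2) no two shaded boxes in the same column have the same entry; (IT3) $T(i,i+1)\le i$ for all $1\le i<n$. Chute moves: for inversions tableaux $T,T'$ of shape $w$ and $i<j$ with $T(i,j)=a$, $T'$ is obtained from $T$ by the chute move $C_{ij}$ (written $T'=C_{ij}T$) if: 1. $T'(i,j)=b$, where $b$ is the smallest number with $b>a$ and $b\notin\{T(r,j): r<i\}$; 2. for some (possibly empty) set of values $k>j$, $T(i,k)=a=T'(j,k)$ and $T(j,k)=b=T'(i,k)$; 3. $T(h,l)=T'(h,l)$ for all other pairs $(h,l)$. Lehmer tableau: $\Lambda(T)(i,j)$, for $(i,j)\in\mathrm{Inv}(w)$, is the number of integers $k$ with $1\le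 k<T(i,j)$ that do not appear below box $(i,j)$ in column $j$ of $T$, i.e. with $k\ne T(r,j)$ for all $r<i$. *)

(* Defs.v *)
From Stdlib Require Export Relation_Operators.
From mathcomp Require Export all_boot perm matrix.

Set Implicit Arguments.
Unset Strict Implicit.
Unset Printing Implicit Defensive.

(* The ordinal i : 'I_n stands for the index i + 1 of {1, ..., n}; the entries
   of tableaux are not shifted.  A filling of the staircase is a matrix of
   naturals in which T i j is the entry in row i and column j; rows are drawn
   from bottom to top, so r < i means that (r, j) lies below (i, j). *)

Definition Inv (n : nat) (w : 'S_n) : {set 'I_n * 'I_n} :=
  [set p : 'I_n * 'I_n | (p.1 < p.2) && (w p.2 < w p.1)].

(* The median of a list of odd length. *)
Definition median (s : seq nat) : nat := nth 0 (sort leq s) (size s)./2.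

Definition hook (n : nat) (T : 'M[nat]_n) (i j : 'I_n) : seq nat :=
  T i j :: [seq T i' j | i' : 'I_n <- enum 'I_n & i < i' < j]
        ++ [seq T i j' | j' : 'I_n <- enum 'I_n & i < j' < j].

Definition below (n : nat) (T : 'M[nat]_n) (i j : 'I_n) : seq nat :=
  [seq T r j | r : 'I_n <- enum 'I_n & r < i].

(* The second field also sets to 0 the positions i >= j, which are not boxes of
   the staircase, so that equality of matrices is equality of tableaux.
   In the last field, i.+1 is the label of row i. *)
Record inversions_tableau (n : nat) (w : 'S_n) (T : 'M[nat]_n) : Prop :=
  InversionsTableau {
    it_shaded : forall i j, (i, j) \in Inv w -> 1 <= T i j <= n;
    it_unshaded : forall i j, (i, j) \notin Inv w -> T i j = 0;
    it_median : forall i j : 'I_n, i < j -> T i j = median (hook T i j);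
    it_column : forall i i' j, (i, j) \in Inv w -> (i', j) \in Inv w ->
      i != i' -> T i j <> T i' j;
    it_flag : forall i j : 'I_n, j = i.+1 :> nat -> T i j <= i.+1
  }.

Record chute_move (n : nat) (w : 'S_n) (i j : 'I_n) (T T' : 'M[nat]_n) : Prop :=
  ChuteMove {
    chute_source : inversions_tableau w T;
    chute_target : inversions_tableau w T';
    chute_box : i < j;
    chute_gt : T i j < T' i j;
    chute_notin : T' i j \notin below T i j;
    chute_min : forall c, T i j < c -> c \notin below T i j -> T' i j <= c;
    chute_rows : exists K : {set 'I_n},
      (forall k, k \in K ->
         [/\ j < k, T i k = T i j, T' j k = T i j,
             T j k = T' i j & T' i k = T' i j]) /\
      (forall h l, (h, l) <> (i, j) ->
         ~ (l \in K /\ (h = i \/ h = j)) -> T h l = T' h l)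
  }.

Definition chute_step (n : nat) (w : 'S_n) (T T' : 'M[nat]_n) : Prop :=
  exists i j : 'I_n, chute_move w i j T T'.

Definition chute_series (n : nat) (w : 'S_n) : 'M[nat]_n -> 'M[nat]_n -> Prop :=
  clos_refl_trans_1n _ (chute_step w).

Definition Lehmer (n : nat) (T : 'M[nat]_n) (i j : 'I_n) : nat :=
  count (fun k => k \notin below T i j) (index_iota 1 (T i j)).

(* Main.v *)
Require Import Defs.
From mathcomp Require Import zify.

(** The idea.  It is enough to treat a single chute move C_ij, which replaces
    a = T(i,j) by b > a and, for each k in some set K, exchanges the entries
    a = T(i,k) and b = T(j,k) of column k.  Call c >= 1 free at a box if c is
    smaller than its entry and does not occur below it, so that the Lehmer
    tableau counts the free values.

    Going through the boxes, the free values of T inject into those of T' for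
    elementary reasons, except at the boxes (j,k) with k in K, where the entry
    drops from b to a.  There, c |-> c is still an injection provided that no
    value c with a < c < b is free, and this is where the median condition
    enters.  It forces T(x,z) to lie between T(x,y) and T(y,z) whenever
    x < y < z ([inversions_tableau_between]).  By minimality of b, the value c
    occurs as T(r,j) for some r < i.  Betweenness for r < j < k gives
    c <= T(r,k) in T, as T(j,k) = b > c, and T(r,k) <= c in T', as
    T'(j,k) = a < c.  A chute move changes neither (r,j) nor (r,k), so
    T(r,k) = c and c is not free at (j,k)
    ([chute_move_gap_below]). *)

(** * Medians and betweenness *)

(** In the sorted list the first m + 1 entries are at most the median, so only
    the last m can exceed it. *)
Lemma count_gt_median (s : seq nat) (m : nat) :
  size s = (m + m).+1 -> count (fun x => median s < x) s <= m.
Proof.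
move=> sz; have szm : (size s)./2 = m by lia.
have srt : sorted leq (sort leq s) by apply: sort_sorted; exact: leq_total.
rewrite -(seq.permP (permEl (perm_sort leq s))) /median szm.
set s' := sort leq s in srt *.
have sz' : size s' = (m + m).+1 by rewrite size_sort.
rewrite -{2}(cat_take_drop m.+1 s') count_cat.
rewrite (_ : count _ (take _ _) = 0) ?add0n; last first.
  apply/eqP; rewrite -leqn0 leqNgt -has_count; apply/hasPn => x.
  move=> /(nthP 0) [l]; rewrite size_take_min sz' => hl <-.
  rewrite nth_take -?leqNgt; last by lia.
  apply: (sorted_leq_nth leq_trans leqnn) => //; rewrite ?inE ?sz'; lia.
by apply: leq_trans (count_size _ _) _; rewrite size_drop sz'; lia.
Qed.

Lemma count_lt_median (s : seq nat) (m : nat) :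
  size s = (m + m).+1 -> count (fun x => x < median s) s <= m.
Proof.
move=> sz; have szm : (size s)./2 = m by lia.
have srt : sorted leq (sort leq s) by apply: sort_sorted; exact: leq_total.
rewrite -(seq.permP (permEl (perm_sort leq s))) /median szm.
set s' := sort leq s in srt *.
have sz' : size s' = (m + m).+1 by rewrite size_sort.
rewrite -{2}(cat_take_drop m s') count_cat.
rewrite (_ : count _ (drop _ _) = 0) ?addn0; last first.
  apply/eqP; rewrite -leqn0 leqNgt -has_count; apply/hasPn => x.
  move=> /(nthP 0) [l]; rewrite size_drop sz' => hl <-.
  rewrite nth_drop -leqNgt.
  apply: (sorted_leq_nth leq_trans leqnn) => //; rewrite ?inE ?sz'; lia.
by apply: leq_trans (count_size _ _) _; rewrite size_take_min; lia.
Qed.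

(** The pairs of boxes (i,y), (y,k) partition the hook without its corner (i,k).
    If every pair had a member satisfying P, then the pair of j, which has two,
    would make the number of such boxes exceed the number of pairs. *)
Lemma hook_pair_opposite (n : nat) (T : 'M[nat]_n) (P : pred nat)
    (i j k : 'I_n) :
  count P (hook T i k) <= size [seq y : 'I_n <- enum 'I_n | i < y < k] ->
  i < j < k -> P (T i j) -> P (T j k) ->
  exists y : 'I_n, [/\ i < y < k, ~~ P (T i y) & ~~ P (T y k)].
Proof.
rewrite /hook /= count_cat !count_map; set L := [seq y <- _ | _].
move=> le_count ijk Pij Pjk.
have jL : j \in L by rewrite mem_filter ijk mem_enum.
pose Q := predU (preim (T i) P) (preim (T^~ k) P).
have [allQ | /allPn [y]] := boolP (all Q L); last first.
  rewrite mem_filter mem_enum andbT => iyk; rewrite negb_or => /andP [Ni Nk].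
  by exists y.
have I_gt0 : 0 < count (predI (preim (T i) P) (preim (T^~ k) P)) L.
  by rewrite -has_count; apply/hasP; exists j => //; apply/andP.
have := leq_trans (leq_addl _ _) le_count.
rewrite all_count in allQ; rewrite addnC -count_predUI (eqP allQ).
by rewrite -[leqRHS]addn0 leq_add2l leqNgt I_gt0.
Qed.

Lemma size_hook (n : nat) (T : 'M[nat]_n) (i k : 'I_n) :
  let m := size [seq y : 'I_n <- enum 'I_n | i < y < k] in
  size (hook T i k) = (m + m).+1.
Proof. by rewrite /hook /= size_cat !size_map. Qed.

(** If both T(i,j) and T(j,k) were larger than T(i,k), then by the median
    condition T(i,y) and T(y,k) would both be at most T(i,k) for some y, and the
    betweenness of the two shorter triples formed by j, y and one of i, k gives
    contradictory bounds on the entry in row and column j, y; similarly if both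
    were smaller. *)
Lemma inversions_tableau_between (n : nat) (w : 'S_n) (T : 'M[nat]_n)
    (i j k : 'I_n) :
  inversions_tableau w T -> i < j -> j < k ->
  minn (T i j) (T j k) <= T i k <= maxn (T i j) (T j k).
Proof.
move=> hT.
have [d] := ubnP (k - i); elim: d i j k => // d IHd i j k le_d ij jk.
have ik := ltn_trans ij jk; have med := it_median hT ik.
have ijk : i < j < k by rewrite ij jk.
apply/andP; split; rewrite leqNgt; apply/negP.
- rewrite leq_min => /andP [Pij Pjk].
  have := count_gt_median _ _ (size_hook n T i k); rewrite -med.
  move=> /hook_pair_opposite /(_ ijk Pij Pjk) [y [/andP [iy yk]]].
  case: (ltngtP j y) => [jy|yj|/val_inj <-]; last by rewrite Pij.
    have := IHd i j y ltac:(lia) ij jy; have := IHd j y k ltac:(lia) jy yk.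
    by lia.
  have := IHd i y j ltac:(lia) iy yj; have := IHd y j k ltac:(lia) yj jk.
  by lia.
- rewrite gtn_max => /andP [Pij Pjk].
  have := count_lt_median _ _ (size_hook n T i k); rewrite -med.
  move=> /(hook_pair_opposite n T (fun x => x < T i k)) /(_ ijk Pij Pjk).
  move=> [y [/andP [iy yk]]].
  case: (ltngtP j y) => [jy|yj|/val_inj <-]; last by rewrite Pij.
    have := IHd i j y ltac:(lia) ij jy; have := IHd j y k ltac:(lia) jy yk.
    by lia.
  have := IHd i y j ltac:(lia) iy yj; have := IHd y j k ltac:(lia) yj jk.
  by lia.
Qed.

(** * Comparing Lehmer tableaux *)

Lemma belowP (n : nat) (T : 'M[nat]_n) (i j : 'I_n) (c : nat) :
  reflect (exists2 r : 'I_n, r < i & T r j = c) (c \in below T i j).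
Proof.
apply: (iffP mapP) => [[r]|[r ri <-]].
  by rewrite mem_filter => /andP [ri _] ->; exists r.
by exists r => //; rewrite mem_filter ri mem_enum.
Qed.

Lemma inversions_tableau_col_inj (n : nat) (w : 'S_n) (T : 'M[nat]_n)
    (p r q : 'I_n) :
  inversions_tableau w T -> 0 < T p q -> T p q = T r q -> p = r.
Proof.
move=> hT T_gt0 eqT; apply/eqP/negPn/negP => npr.
have shaded x : 0 < T x q -> (x, q) \in Inv w.
  by move=> x_gt0; apply/negPn/negP => /(it_unshaded hT) x0; rewrite x0 in x_gt0.
by apply: (it_column hT (shaded p T_gt0) _ npr) => //; apply: shaded; rewrite -eqT.
Qed.

Lemma Lehmer_le_inj (n : nat) (T T' : 'M[nat]_n) (p q : 'I_n)
    (f : nat -> nat) :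
  {in [pred c | (0 < c < T p q) && (c \notin below T p q)] &, injective f} ->
  (forall c, 0 < c < T p q -> c \notin below T p q ->
     0 < f c < T' p q /\ f c \notin below T' p q) ->
  Lehmer T p q <= Lehmer T' p q.
Proof.
move=> f_inj fP; rewrite /Lehmer -!size_filter.
set s := [seq _ <- index_iota 1 (T p q) | _].
have sP c : c \in s -> (0 < c < T p q) && (c \notin below T p q).
  by rewrite mem_filter mem_index_iota andbC.
rewrite -(size_map f); apply: uniq_leq_size => [|_ /mapP [c /sP /andP [h1 h2] ->]].
  rewrite map_inj_in_uniq ?filter_uniq ?iota_uniq // => c c' /sP cs /sP c's.
  exact: f_inj.
by have [h3 h4] := fP c h1 h2; rewrite mem_filter mem_index_iota h3 h4.
Qed.

(** Below a box in row p > i, a chute move replaces an occurrence of a by b, or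
    exchanges the two, where a and b are the entries of row i before and after
    the move.  In both cases c |-> c, except b |-> a, maps free values
    to free values, and it is injective because a is not free in T. *)
Lemma Lehmer_le_replace (n : nat) (w : 'S_n) (T T' : 'M[nat]_n)
    (p q i : 'I_n) :
  inversions_tableau w T -> T p q = T' p q -> i < p ->
  0 < T i q -> T i q < T' i q ->
  (forall r : 'I_n, r < p -> r != i -> T r q = T' r q \/
     T' r q = T i q /\ T r q = T' i q) ->
  Lehmer T p q <= Lehmer T' p q.
Proof.
move=> hT eq_pq ip a_gt0 ab rows.
have a_below : T i q \in below T p q by apply/belowP; exists i.
apply: (Lehmer_le_inj n T T' p q (fun c => if c == T' i q then T i q else c)).
  move=> c c'; rewrite !inE => /andP [_ nc] /andP [_ nc'].
  case: eqP => [->|_]; case: eqP => [->|_] // e.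
    by rewrite -e a_below in nc'.
  by rewrite e a_below in nc.
move=> c hc nc; case: eqP => [cb|/eqP ncb].
  split; first by rewrite -eq_pq; lia.
  apply/belowP => -[r rp Tr].
  have nri : r != i by apply: contraTneq ab => ri; rewrite -Tr ri ltnn.
  case: (rows r rp nri) => [eqr|[_ eqr]].
    have := inversions_tableau_col_inj n w T i r q hT a_gt0.
    by rewrite eqr Tr => /(_ erefl) ir; rewrite ir eqxx in nri.
  by case/belowP: nc; exists r => //; rewrite eqr.
split; first by rewrite -eq_pq.
apply/belowP => -[r rp Tr].
have nri : r != i by apply: contra_neq ncb => ri; rewrite -Tr ri.
case: (rows r rp nri) => [eqr|[eqr _]].
  by case/belowP: nc; exists r => //; rewrite eqr.
by rewrite -Tr eqr a_below in nc.
Qed.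

(** * Chute moves *)

(** Applying betweenness to r < j < k in both T and T' pins down T(r,k), where
    (r,j) is the box of column j that contains c. *)
Lemma chute_move_gap_below (n : nat) (w : 'S_n) (T T' : 'M[nat]_n)
    (i j k : 'I_n) (c : nat) :
  chute_move w i j T T' -> j < k ->
  T j k = T' i j -> T' j k = T i j ->
  (forall r : 'I_n, r < i -> T r j = T' r j /\ T r k = T' r k) ->
  T i j < c < T' i j -> c \in below T j k.
Proof.
move=> mv jk Tjk T'jk rows /andP [ac cb]; have ij := chute_box mv.
have : c \in below T i j.
  by apply: contraTT cb => /(chute_min mv ac); rewrite -leqNgt.
case/belowP => r ri Trj; apply/belowP; exists r; first exact: ltn_trans ij.
have [eq_rj eq_rk] := rows r ri; have rj := ltn_trans ri ij.
have := inversions_tableau_between n w T r j k (chute_source mv) rj jk.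
have := inversions_tableau_between n w T' r j k (chute_target mv) rj jk.
by rewrite -eq_rj -eq_rk Tjk T'jk Trj; lia.
Qed.

Lemma chute_move_Lehmer_le (n : nat) (w : 'S_n) (T T' : 'M[nat]_n)
    (i j p q : 'I_n) :
  chute_move w i j T T' -> (p, q) \in Inv w -> Lehmer T p q <= Lehmer T' p q.
Proof.
move=> mv pq_inv.
have hT := chute_source mv; have hT' := chute_target mv.
have ij := chute_box mv; have ab := chute_gt mv.
have pq : p < q by move: pq_inv; rewrite inE => /andP [].
have a_gt0 : 0 < T i j.
  have /(it_shaded hT) /andP [] // : (i, j) \in Inv w.
  by apply/negPn/negP => /(it_unshaded hT') b0; rewrite b0 in ab.
have [K [KP eqT]] := chute_rows mv.
have jK : j \notin K by apply/negP => /KP []; rewrite ltnn.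
have nij : i != j by apply: contraTneq ij => ->; rewrite ltnn.
have Lehmer_le_id : T p q <= T' p q ->
    (forall r : 'I_n, r < p -> T r q = T' r q) -> Lehmer T p q <= Lehmer T' p q.
  move=> le_pq rows; apply: (Lehmer_le_inj n T T' p q id) => [//|c hc nc].
  split; first by lia.
  apply: contra nc => /belowP [r rp <-]; apply/belowP; exists r => //.
  exact: rows.
have [qj | nqj] := eqVneq q j.
  subst q.
  have rows (r : 'I_n) : r != i -> T r j = T' r j.
    by move=> nri; apply: eqT => [[/eqP]|[]]; rewrite ?(negPf nri) ?(negPf jK).
  case: (ltngtP p i) => [pi|ip|/val_inj pi].
  - apply: Lehmer_le_id => [|r rp]; last by rewrite rows -?val_eqE //=; lia.
    by rewrite rows -?val_eqE //=; lia.
  - apply: (Lehmer_le_replace n w T T' p j i) => // [|r _ nri].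
      by rewrite rows -?val_eqE //=; lia.
    by left; apply: rows.
  - subst p; apply: Lehmer_le_id => [|r rp]; first exact: ltnW.
    by rewrite rows -?val_eqE //=; lia.
have [qK | nqK] := boolP (q \in K); last first.
  have rows (r : 'I_n) : T r q = T' r q.
    by apply: eqT => [[_ /eqP]|[]]; rewrite ?(negPf nqj) ?(negPf nqK).
  by apply: Lehmer_le_id => [|r _]; rewrite rows.
have [jq Tiq T'jq Tjq T'iq] := KP q qK.
have rows (r : 'I_n) : r != i -> r != j -> T r q = T' r q.
  move=> nri nrj; apply: eqT => [[/eqP]|[_ [] /eqP]].
  - by rewrite (negPf nri).
  - by rewrite (negPf nri).
  - by rewrite (negPf nrj).
have rows_lt (r : 'I_n) : r < i -> T r q = T' r q.
  by move=> ri; apply: rows; rewrite -val_eqE /=; lia.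
case: (ltngtP p i) => [pi|ip|/val_inj pi].
- by apply: Lehmer_le_id => [|r rp]; rewrite rows_lt //; lia.
- have [pj | npj] := eqVneq p j.
    (* The entry drops from b to a, but every c with a <= c < b occurs below the
       box in T, so that all values counted for T are smaller than a. *)
    subst p; apply: (Lehmer_le_inj n T T' j q id) => [//|c hc nc].
    have nca : c != T i j.
      by apply: contraNneq nc => ->; apply/belowP; exists i.
    have nac : ~~ (T i j < c).
      apply: contra nc => ac; apply: (chute_move_gap_below n w T T' i j q) => //.
        move=> r ri; split; last exact: rows_lt.
        apply: eqT => [[ri']|[jK' _]]; last by rewrite jK' in jK.
        by rewrite ri' ltnn in ri.
      by rewrite ac; lia.
    split; first by lia.
    apply/belowP => -[r rj Tr].
    have [ri | nri] := eqVneq r i; first by move: Tr; rewrite ri T'iq; lia.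
    have nrj : r != j by rewrite -val_eqE /=; lia.
    by case/belowP: nc; exists r => //; rewrite rows.
  apply: (Lehmer_le_replace n w T T' p q i) => // [|||r rp nri].
  + by apply: rows; rewrite // -val_eqE /=; lia.
  + by rewrite Tiq.
  + by rewrite Tiq T'iq.
  + have [-> | nrj] := eqVneq r j; first by right; rewrite T'jq Tiq Tjq T'iq.
    by left; apply: rows.
- subst p; apply: Lehmer_le_id => [|r ri]; last exact: rows_lt.
  by rewrite Tiq T'iq ltnW.
Qed.

Theorem corollary6p16 (n : nat) (w : 'S_n) (T T' : 'M[nat]_n)
    (hT : inversions_tableau w T) (hT' : inversions_tableau w T')
    (hTT' : chute_series w T T') (i j : 'I_n) (hij : (i, j) \in Inv w) :
  Lehmer T i j <= Lehmer T' i j.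
Proof.
elim: hTT' {hT hT'} => [//|T1 T2 T3 [x [y mv]] _ IH].
exact: leq_trans (chute_move_Lehmer_le n w T1 T2 x y i j mv hij) IH.
Qed.
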